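(* Let $n>m>1$ be integers and let $\mathcal{N}=\{L_1,\ldots,L_n\}$ be a normal system of cardinality $n$ in $\mathbb{R}^m$, with fixed coefficient matrix $[a_{ij}]\in M_{n\times m}(\mathbb{R})$. Then: (1) there is a bijection between the isomorphism classes of generic hyperplane arrangements $\{H_1,\ldots,H_n\}$ in $\mathbb{R}^m$ with normal system $\mathcal{N}$, under isomorphisms which are trivial on subscripts, and the antipodal pairs $\{C,-C\}$ of convex cones of the associated discriminantal arrangement $\mathcal{C}^n_{\binom{n}{m+1}}$; (2) consequently, the number of such isomorphism classes equals exactly half the number of convex cones of $\mathcal{C}^n_{\binom{n}{m+1}}$.
   Context: A normal system in $\mathbb{R}^m$ is a set $\mathcal{N}=\{L_1,\ldots,L_n\}$ of lines through the origin together with chosen nonzero vectors $v_i=(a_{i1},\ldots,a_{im})\in L_i$ such that every subset of $\{v_1,\ldots,v_n\}$ of cardinality at most $m$ is linearly independent; the matrix $[a_{ij}]_{1\le i\le n,1\le j\le m}$ is fixed once and for all. A hyperplane arrangement with normal system $\mathcal{N}$ is $\{H_1,\ldots,H_n\}$ with $H_i:\sum_{j=1}^m a_{ij}x_j=b_i$ for some $b=(b_1,\ldots,b_n)\in\mathbb{R}^n$. An arrangement of $n$ affine hyperplanes in $\mathbb{R}^m$ is generic if for $1\le r\le m$ any $r$ of them intersect in a set of dimension $m-r$, and for $r>m$ any $r$ of them have empty intersection. For two generic arrangements $\{H^1_i\}$, $\{H^2_i\}$ (indexed by $1,\ldots,n$), an isomorphism trivial on subscripts is the bijection $H^1_i\mapsto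 H^2_i$ such that for every $(m-1)$-subset $A\subset\{1,\ldots,n\}$, the linear order of the vertices $\bigcap_{i\in A}H^1_i\cap H^1_k$ ($k\notin A$) along the line $\bigcap_{i\in A}H^1_i$ agrees, via $k\mapsto k$, with the order of the vertices $\bigcap_{i\in A}H^2_i\cap H^2_k$ along the line $\bigcap_{i\in A}H^2_i$, up to reversal of one of the orders. The discriminantal arrangement $\mathcal{C}^n_{\binom{n}{m+1}}$ is the central arrangement in $\mathbb{R}^n$ (coordinates $y_1,\ldots,y_n$) consisting of, for each $1\le i_1<\cdots<i_{m+1}\le n$, the hyperplane $M_{\{i_1,\ldots,i_{m+1}\}}$ given by vanishing of the determinant of the $(m+1)\times(m+1)$ matrix whose $k$-th row is $(a_{i_k1},\ldots,a_{i_km},y_{i_k})$. Its convex cones are the (closures of the) connected components of the complement of the union of these hyperplanes in $\mathbb{R}^n$; an antipodal pair is $\{C,-C\}$. *)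

(* Defs.v *)
From HB Require Import structures.
From mathcomp Require Import all_boot all_order all_algebra.
From mathcomp Require Import all_classical all_reals all_analysis.
Set Implicit Arguments.
Unset Strict Implicit.
Unset Printing Implicit Defensive.
Import Order.TTheory GRing.Theory Num.Theory.
Import numFieldNormedType.Exports.
Local Open Scope classical_set_scope.
Local Open Scope ring_scope.

Section Arrangements.
Context {R : realType} {n m : nat}.

(* The rows of a are the vectors v_i chosen on the lines L i. *)
Definition normal_system (L : 'I_n -> {vspace 'rV[R]_m}) (a : 'M[R]_(n, m)) :=
  [/\ injective L,
      forall i, \dim (L i) = 1%N,
      forall i, row i a != 0 /\ row i a \in L i &
      forall S : {set 'I_n}, (#|S| <= m)%N -> free [seq row i a | i in S]].

Definition hyperplane (a : 'M[R]_(n, m)) (b : 'rV[R]_n) (i : 'I_n) :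
    set 'rV[R]_m :=
  [set x : 'rV[R]_m | \sum_(j < m) a i j * x 0 j = b 0 i].

Definition inter (H : 'I_n -> set 'rV[R]_m) (S : {set 'I_n}) : set 'rV[R]_m :=
  \bigcap_(i in [set` S]) H i.

Definition has_affine_dim (X : set 'rV[R]_m) (d : nat) :=
  exists (p : 'rV[R]_m) (U : {vspace 'rV[R]_m}),
    \dim U = d /\ X = [set p + u | u in [set` U]].

Definition generic (H : 'I_n -> set 'rV[R]_m) :=
  forall S : {set 'I_n},
    ((0 < #|S| <= m)%N -> has_affine_dim (inter H S) (m - #|S|)) /\
    ((m < #|S|)%N -> inter H S = set0).

Definition generic_arrangements (a : 'M[R]_(n, m)) :
    set ('I_n -> set 'rV[R]_m) :=
  [set H | (exists b : 'rV[R]_n, H = hyperplane a b) /\ generic H].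

Definition line_direction (X : set 'rV[R]_m) (d : 'rV[R]_m) :=
  d != 0 /\ exists p : 'rV[R]_m, X = [set p + t *: d | t in [set: R]].

(* The vertex on H k strictly precedes the vertex on H l along the line       *)
(* inter H S oriented by d.                                                   *)
Definition vertex_before (H : 'I_n -> set 'rV[R]_m) (S : {set 'I_n})
    (d : 'rV[R]_m) (k l : 'I_n) :=
  exists (x y : 'rV[R]_m) (t : R),
    [/\ (inter H S `&` H k) x, (inter H S `&` H l) y, 0 < t & y = x + t *: d].

(* The orientations d1 and d2 of the two lines are arbitrary; the second      *)
(* alternative is agreement after reversing one of the two orders.            *)
Definition iso_trivial_on_subscripts (H1 H2 : 'I_n -> set 'rV[R]_m) :=
  forall S : {set 'I_n}, #|S| = m.-1 ->
  forall d1 d2 : 'rV[R]_m,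
    line_direction (inter H1 S) d1 -> line_direction (inter H2 S) d2 ->
    (forall k l, k \notin S -> l \notin S ->
       (vertex_before H1 S d1 k l <-> vertex_before H2 S d2 k l)) \/
    (forall k l, k \notin S -> l \notin S ->
       (vertex_before H1 S d1 k l <-> vertex_before H2 S d2 l k)).

Definition iso_classes (a : 'M[R]_(n, m)) :
    set (set ('I_n -> set 'rV[R]_m)) :=
  [set [set K | generic_arrangements a K /\ iso_trivial_on_subscripts H K]
     | H in generic_arrangements a].

Definition discriminantal_hyperplane (a : 'M[R]_(n, m))
    (f : 'I_(m + 1) -> 'I_n) : set 'rV[R]_n :=
  [set y : 'rV[R]_n | \det (row_mx (rowsub f a) (\col_k y 0 (f k))) = 0].

(* A subset i_1 < ... < i_(m+1) of the indices is its increasing enumeration. *)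
Definition discriminantal_arrangement (a : 'M[R]_(n, m)) :
    set (set 'rV[R]_n) :=
  [set discriminantal_hyperplane a f
     | f in [set f : 'I_(m + 1) -> 'I_n | {homo f : i j / (i < j)%N}]].

Definition convex_cones (a : 'M[R]_(n, m)) : set (set 'rV[R]_n) :=
  let U := ~` \bigcup_(M in discriminantal_arrangement a) M in
  [set closure (connected_component U y) | y in U].

Definition antipodal_pairs (a : 'M[R]_(n, m)) : set (set (set 'rV[R]_n)) :=
  [set [set C; [set - x | x in C]] | C in convex_cones a].

End Arrangements.

(* Main.v *)
(* Write D_f(y) for the determinant attached to an (m+1)-tuple f of indices. It
   is linear in y and vanishes exactly when the hyperplanes of the tuple have a
   common point; hence the arrangement with constants y is generic iff y avoids
   the discriminantal arrangement.  On the line of S, after translating the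
   origin to the vertex of H_k, only the l-th entry of y survives in D_f(y) for
   f enumerating S, k, l; so the order of the vertices k, l is given by the
   sign of D_f(y) times a factor independent of y.  Two generic arrangements
   are therefore isomorphic iff on every S the sign vectors (D_f) agree up to a
   sign depending on S, and connectedness of the Johnson graph makes this sign
   global.  Since the cones are the sets of constant sign vector, the
   classes are the sign vectors modulo global negation, which has no fixed
   point because n > m. *)
Require Import Defs.
From HB Require Import structures.
From mathcomp Require Import all_boot all_order all_algebra.
From mathcomp Require Import ring.
From mathcomp Require Import all_classical all_reals all_analysis.
Set Implicit Arguments.
Unset Strict Implicit.
Unset Printing Implicit Defensive.
Import Order.TTheory GRing.Theory Num.Theory.
Import numFieldNormedType.Exports.
Local Open Scope classical_set_scope.
Local Open Scope ring_scope.
Local Open Scope card_scope.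

(** * Increasing enumerations and signs of products *)

Lemma homo_ltn_inj {p q : nat} (f : 'I_p -> 'I_q) :
  {homo f : i j / (i < j)%N} -> injective f.
Proof.
move=> fS i j fij; apply/val_inj.
by case: (ltngtP i j) => // /fS; rewrite fij ltnn.
Qed.

(** Links the increasing tuples that index [discriminantal_arrangement] with the index subsets and
    injective tuples used in the proofs. *)
Lemma increasing_enum {n p : nat} (T : {set 'I_n}) : #|T| = p ->
  exists f : 'I_p -> 'I_n, {homo f : i j / (i < j)%N} /\ f @: 'I_p = T.
Proof.
move=> Tp; pose f (q : 'I_p) := enum_val (cast_ord (esym Tp) q).
have fS : {homo f : i j / (i < j)%N}.
  move=> i j ij; rewrite /f !(enum_val_nth (f i)) /=.
  have ltr : transitive (relpre (val : 'I_n -> nat) ltn).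
    by move=> ? ? ?; apply: ltn_trans.
  have srt : sorted (relpre val ltn) (enum T).
    rewrite /enum_mem; apply: sorted_filter => //.
    by rewrite -enumT -sorted_map val_enum_ord iota_ltn_sorted.
  by apply: (sorted_ltn_nth ltr _ srt); rewrite ?inE -?cardE ?Tp ?ltn_ord.
exists f; split=> //; apply/eqP; rewrite eqEcard card_imset ?card_ord ?Tp ?leqnn.
  by rewrite andbT; apply/fintype.subsetP => _ /imsetP [q _ ->]; apply: enum_valP.
exact: homo_ltn_inj.
Qed.

(** Scaling [u * w] by [v ^+ 2] and [v * w] by [u * v], both positive, gives the same number. *)
Lemma mulr_gt0_congr {R : realDomainType} (u v w : R) :
  0 < u * v -> (0 < u * w) = (0 < v * w).
Proof.
move=> uv; have v2 : 0 < v ^+ 2.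
  rewrite exprn_even_gt0//=; apply/eqP => v0.
  by rewrite v0 mulr0 ltxx in uv.
by rewrite -(pmulr_lgt0 _ v2) -(pmulr_rgt0 (v * w) uv); congr (0 < _); ring.
Qed.

(** Meant for [u], [v] the values of one discriminant at two arrangements and [w] the factor turning
    such a value into an order of two vertices: reversed orders exclude equal signs. *)
Lemma mulr_gt0_opp {R : realDomainType} (u v w : R) :
  v * w != 0 -> (0 < u * w <-> v * w < 0) -> ~ 0 < u * v.
Proof.
move=> vw [H1 H2] /mulr_gt0_congr E; move: H1 H2; rewrite E; move: vw.
by case: ltgtP => // _ _ H1 H2; [have := H1 isT | have := H2 isT].
Qed.

Lemma mulr_gt0_iff {R : realDomainType} (u v w : R) :
  u != 0 -> v * w != 0 -> (0 < u * w <-> 0 < v * w) -> 0 < u * v.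
Proof.
move=> u0 vw H; have v0 : v != 0 by apply: contraNneq vw => ->; rewrite mul0r.
have : ~ 0 < u * - v.
  by apply: (@mulr_gt0_opp _ _ _ w); rewrite mulNr ?oppr_eq0// oppr_lt0.
rewrite mulrN oppr_gt0; have : u * v != 0 by rewrite mulf_neq0.
by case: ltgtP.
Qed.

(** * Discriminants as linear forms in the constants *)

Definition disc {R : realType} {n m : nat} (a : 'M[R]_(n, m))
    (f : 'I_(m + 1) -> 'I_n) (y : 'rV[R]_n) : R :=
  \det (row_mx (rowsub f a) (\col_k y 0 (f k))).

Section Discriminants.
Context {R : realType} {n m : nat}.
Implicit Types (a : 'M[R]_(n, m)) (x p d : 'rV[R]_m) (y z b : 'rV[R]_n).
Implicit Types (S : {set 'I_n}) (i k l : 'I_n) (f g : 'I_(m + 1) -> 'I_n).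

Lemma mulmx_trE a x i : (x *m a^T) 0 i = \sum_(j < m) a i j * x 0 j.
Proof. by rewrite mxE; apply: eq_bigr => j _; rewrite mxE mulrC. Qed.

Lemma hyperplaneE a b i x : hyperplane a b i x <-> (x *m a^T) 0 i = b 0 i.
Proof. by rewrite mulmx_trE. Qed.

Lemma interP a b S x :
  inter (hyperplane a b) S x <-> forall i, i \in S -> (x *m a^T) 0 i = b 0 i.
Proof.
split=> [Hx i iS|Hx i iS]; first exact/hyperplaneE/Hx.
exact/hyperplaneE/Hx.
Qed.

Lemma inter_direction a b S p d :
    inter (hyperplane a b) S p -> inter (hyperplane a b) S (p + d) ->
  forall i, i \in S -> (d *m a^T) 0 i = 0.
Proof.
move=> /interP pS /interP pdS i iS.
by have := pdS i iS; rewrite mulmxDl mxE pS// => /(canRL (addKr _)); rewrite addNr.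
Qed.

Lemma disc_linear a f : linear (disc a f).
Proof.
(* After transposition [y] fills the last row. Deleting that row leaves a matrix free of [y], as
   multilinearity in the last row requires. *)
move=> c y z; have keep (B C : 'rV_(m + 1)) :
    row' (rshift m ord0) (col_mx (rowsub f a)^T B) =
    row' (rshift m ord0) (col_mx (rowsub f a)^T C).
  apply/matrixP => i j; rewrite !mxE; case: splitP => // k.
  have im : (i < m)%N by move: (nat_of_ord i) (ltn_ord i) => i'; rewrite addn1.
  by rewrite (ord1 k) /= !addn0 /bump leqNgt im => /= Ei;
    rewrite add0n in Ei; rewrite {}Ei ltnn in im.
rewrite /disc -![\det (row_mx _ _)]det_tr !tr_row_mx -[X in _ = _ + X]mul1r.
apply: (@determinant_multilinear _ _ _ _ _ (rshift m ord0)) => //.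
by rewrite !rowKd; apply/rowP => k; rewrite !mxE mul1r.
Qed.

HB.instance Definition _ a f :=
  GRing.isLinear.Build R 'rV[R]_n R _ (disc a f) (disc_linear a f).

Lemma discZ a f c y : disc a f (c *: y) = c * disc a f y.
Proof. exact: linearZ. Qed.

(** The nonzero vector with entries [x] and -1 lies in the kernel. Consequently [disc] is invariant
    under translating an arrangement by [x], which adds [x *m a^T] to the constants. *)
Lemma disc_eval a f x : disc a f (x *m a^T) = 0.
Proof.
apply/eqP; rewrite /disc -det_tr; apply/det0P.
exists (row_mx x (- 1%:M)).
  apply/eqP => /rowP /(_ (rshift m ord0)); rewrite row_mxEr !mxE /=.
  by move/eqP; rewrite oppr_eq0 oner_eq0.
rewrite tr_row_mx mul_row_col mulNmx mul1mx; apply/rowP => k.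
rewrite !mxE; apply/eqP; rewrite subr_eq0; apply/eqP/eq_bigr => j _.
by rewrite !mxE.
Qed.

Lemma eq_disc a f y z : (forall q, y 0 (f q) = z 0 (f q)) ->
  disc a f y = disc a f z.
Proof.
move=> yz; rewrite /disc; congr (\det (row_mx _ _)); apply/colP => q.
by rewrite !mxE.
Qed.

Lemma disc_solvable a f y x :
  (forall q, (x *m a^T) 0 (f q) = y 0 (f q)) -> disc a f y = 0.
Proof. by move=> xy; rewrite -(disc_eval a f x); apply: eq_disc. Qed.

(** All injective tuples are allowed, so that no order of the indices has to be maintained;
    vanishing depends only on the image of the tuple. *)
Definition regular a y := forall f, injective f -> disc a f y != 0.

Definition same_signs a y z :=
  forall f, injective f -> 0 < disc a f y * disc a f z.

End Discriminants.

(** * Linear systems formed by rows of [a], and common points of hyperplanes *)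

Section NormalSystems.
Context {R : realType} {n m : nat} {L : 'I_n -> {vspace 'rV[R]_m}}
  {a : 'M[R]_(n, m)} (hN : normal_system L a).
Implicit Types (x p d : 'rV[R]_m) (y z b : 'rV[R]_n).
Implicit Types (S : {set 'I_n}) (i k l : 'I_n) (f g : 'I_(m + 1) -> 'I_n).

Lemma rowsub_free S : (#|S| <= m)%N ->
  row_free (rowsub (fun k : 'I_#|S| => enum_val k) a).
Proof.
case: hN => _ _ _ /(_ S) + Sm => /(_ Sm) fr; apply/inj_row_free => v.
rewrite mulmx_sum_row => v0; apply/rowP => k; rewrite mxE.
have /(@freeP _ _ _ (image_tuple (fun i => row i a) S)) := fr.
apply; rewrite -[RHS]v0; apply: eq_bigr => j _; rewrite row_rowsub.
by rewrite (nth_image 0).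
Qed.

(** Independent rows have a right inverse, which produces the solution. *)
Lemma solve_rows S y : (#|S| <= m)%N ->
  exists x, forall i, i \in S -> (x *m a^T) 0 i = y 0 i.
Proof.
move=> /rowsub_free /row_freeP [B AB].
exists (B *m \col_k y 0 (enum_val k))^T => i iS.
rewrite mulmx_trE -(enum_rankK_in iS iS); set k := enum_rank_in _ _.
have := congr1 (fun M => M *m (\col_k y 0 (enum_val k))) AB.
rewrite mul1mx -mulmxA => /colP /(_ k); rewrite !mxE => <-.
by apply: eq_bigr => j _; rewrite !mxE.
Qed.

(** Exactly [m] independent rows have full column rank, hence a left inverse. This is the source of
    all uniqueness of vertices below. *)
Lemma eval_inj S x : #|S| = m -> (forall i, i \in S -> (x *m a^T) 0 i = 0) ->
  x = 0.
Proof.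
move=> Sm x0; have /rowsub_free := eq_leq Sm; set A := rowsub _ _.
rewrite /row_free {2}Sm => /row_fullP [B BA].
apply: trmx_inj; rewrite trmx0 -[LHS]mul1mx -BA -mulmxA.
suff -> : A *m x^T = 0 by rewrite mulmx0.
apply/colP => k; rewrite !mxE -[RHS](x0 _ (enum_valP k)) mulmx_trE.
by apply: eq_bigr => j _; rewrite !mxE.
Qed.

(** The intersection is a translate of the kernel of evaluation on the rows in [S]. Evaluation is
    onto by the right inverse, so rank-nullity gives the dimension. *)
Lemma inter_affine_dim b S : (#|S| <= m)%N ->
  has_affine_dim (inter (hyperplane a b) S) (m - #|S|).
Proof.
move=> Sm; have [p pS] := solve_rows b Sm.
set A := rowsub (fun k : 'I_#|S| => enum_val k) a.
have /row_freeP[B AB] : row_free A by exact: rowsub_free.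
pose F := linfun (mulmxr A^T : 'rV[R]_m -> 'rV[R]_#|S|).
exists p, (lker F); split.
  have := limg_ker_dim F fullv; rewrite capfv.
  have -> : (F @: fullv)%VS = fullv.
    apply/eqP; rewrite eqEsubv subvf; apply/subvP => w _.
    apply/memv_imgP; exists (w *m B^T); rewrite ?memvf// lfunE /=.
    by rewrite -mulmxA -trmx_mul AB trmx1 mulmx1.
  by rewrite !dimvf /dim /= !mul1n => /(canRL (addnK _)).
have FE u : F u = \row_k (u *m a^T) 0 (enum_val k).
  by rewrite lfunE /=; apply/rowP => k; rewrite !mxE; apply: eq_bigr => j _;
    rewrite !mxE.
apply/seteqP; split=> [x /interP xS|_ [u /= uF <-]].
  exists (x - p); rewrite ?subrKC//= memv_ker FE; apply/eqP/rowP => k.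
  by rewrite mxE mulmxBl mxE [X in _ + X]mxE xS ?pS ?enum_valP// subrr mxE.
apply/interP => i iS; rewrite mulmxDl mxE pS//.
move: uF; rewrite memv_ker FE => /eqP /rowP /(_ (enum_rank_in iS i)).
by rewrite !mxE enum_rankK_in // => ->; rewrite addr0.
Qed.

(** A kernel vector has the form [(x, c)]. If [c] vanished, [x] would be killed by [m] independent
    rows and be 0; so dividing [x] by [- c] gives a common point. *)
Lemma disc_eq0 f y : injective f -> disc a f y = 0 ->
  exists x, forall q, (x *m a^T) 0 (f q) = y 0 (f q).
Proof.
move=> finj /eqP; rewrite /disc -det_tr => /det0P [v v0].
rewrite -[v]hsubmxK tr_row_mx mul_row_col.
set x := lsubmx v; set c := rsubmx v => xc.
have {}xc q : (x *m a^T) 0 (f q) = - c 0 0 * y 0 (f q).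
  move: xc => /rowP /(_ q); rewrite !mxE big_ord1 !mxE.
  move/eqP; rewrite addr_eq0 mulNr => /eqP <-.
  by apply: eq_bigr => j _; rewrite !mxE.
have [c0|c0] := eqVneq (c 0 0) 0.
  case/eqP: v0; rewrite -[v]hsubmxK -/x -/c.
  suff -> : x = 0 by rewrite (mx11_scalar c) c0 raddf0 row_mx0.
  apply: (@eval_inj [set f (lshift 1 k) | k : 'I_m]) => [|i /imsetP [k _ ->]].
    by rewrite card_imset ?card_ord// => k l /finj /lshift_inj.
  by rewrite xc c0 oppr0 mul0r.
exists (- (c 0 0)^-1 *: x) => q.
by rewrite -scalemxAl mxE xc mulrA mulrNN mulVf// mul1r.
Qed.

(** * Genericity and the discriminantal arrangement *)

Lemma compl_discriminantal :
  ~` (\bigcup_(M in discriminantal_arrangement a) M) = regular a.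
Proof.
apply/seteqP; split=> y yU.
  move=> f finj; apply/eqP => /(disc_eq0 finj) [x xf]; apply: yU.
  (* The common point [x] carries the vanishing from [f] to the increasing tuple [g] with the same
     image, avoiding permutation signs. *)
  have [|g [gS gf]] := @increasing_enum _ (m + 1) (f @: 'I_(m + 1)).
    by rewrite card_imset// card_ord.
  exists (discriminantal_hyperplane a g); first by exists g.
  rewrite /discriminantal_hyperplane /= -/(disc a g y).
  apply: (@disc_solvable _ _ _ _ _ _ x) => q.
  have /imsetP [r _ ->] : g q \in f @: 'I_(m + 1) by rewrite -gf imset_f.
  exact: xf.
by move=> [_ [f /homo_ltn_inj finj <-] /eqP]; apply/negP/yU.
Qed.

(** The dimension clause holds for every [b] by normality, so only emptiness constrains [b]; for
    larger sets it follows from any [m + 1] of their indices. *)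
Lemma generic_hyperplane b : generic (hyperplane a b) <-> regular a b.
Proof.
split=> [Hgen f finj|breg S].
  apply/eqP => /(disc_eq0 finj) [x xf].
  have [_] := Hgen (f @: 'I_(m + 1)).
  rewrite card_imset// card_ord => /(_ (eq_leq (esym (addn1 m)))) E.
  suff : set0 x by [].
  by rewrite -E; apply/interP => _ /imsetP [q _ ->].
split=> [/andP [_ Sm]|mS]; first exact: inter_affine_dim.
apply/seteqP; split=> // x /interP xS.
have le : (m + 1 <= #|S|)%N by rewrite addn1.
pose f q := enum_val (widen_ord le q).
have finj : injective f by move=> i j /enum_val_inj [] /val_inj.
case/eqP: (breg f finj); apply: (@disc_solvable _ _ _ _ _ _ x) => q.
by rewrite xS ?enum_valP.
Qed.

(** * The order of the vertices on a line *)

Lemma eval_neq0 S k d : #|S| = m.-1 -> k \notin S -> (0 < m)%N -> d != 0 ->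
  (forall i, i \in S -> (d *m a^T) 0 i = 0) -> (d *m a^T) 0 k != 0.
Proof.
move=> Sm kS m0 /eqP d0 dS; apply/eqP => dk; apply: d0.
apply: (@eval_inj (k |: S)); first by rewrite cardsU1 kS Sm add1n prednK.
by move=> i /setU1P [->|/dS].
Qed.

(** The right-hand side does not mention [b]: parallel lines of two arrangements share their
    directions. *)
Lemma line_directionE b S d : (0 < m < n)%N -> #|S| = m.-1 ->
  line_direction (inter (hyperplane a b) S) d <->
  d != 0 /\ forall i, i \in S -> (d *m a^T) 0 i = 0.
Proof.
move=> /andP [m0 mn] Sm; split=> [[d0 [p E]]|[d0 dS]]; split=> //.
  apply: (@inter_direction _ _ _ a b S p); rewrite E.
    by exists 0; rewrite // scale0r addr0.
  by exists 1; rewrite // scale1r.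
have [k kS] : exists k, k \notin S.
  apply/existsP; rewrite -negb_forall; apply/forallP => allS.
  have /subset_leq_card : [set: 'I_n]%SET \subset S by apply/fintype.subsetP => i _.
  by rewrite cardsT card_ord Sm leqNgt (leq_ltn_trans (leq_pred m)).
have dk := eval_neq0 Sm kS m0 d0 dS.
have [|p pS] := @solve_rows S b; first by rewrite Sm leq_pred.
exists p; apply/seteqP; split=> [x /interP xS|_ [t _ <-]]; last first.
  apply/interP => i iS.
  by rewrite mulmxDl -scalemxAl mxE [X in _ + X]mxE pS// dS// mulr0 addr0.
(* As [d] is not parallel to the [k]-th hyperplane, row [k] serves as a coordinate on the line; this
   parameter makes [x] and [p + t *: d] agree on the [m] rows of [k |: S]. *)
exists (((x - p) *m a^T) 0 k / (d *m a^T) 0 k) => //.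
set t := _ / _.
apply/eqP; rewrite eq_sym -subr_eq0 opprD addrA; apply/eqP.
apply: (@eval_inj (k |: S)); first by rewrite cardsU1 kS Sm add1n prednK.
move=> i iS.
rewrite mulmxBl -scalemxAl [LHS]mxE [X in _ + X]mxE [X in _ - X]mxE.
case/setU1P: iS => [->|iS]; first by rewrite /t divfK// subrr.
by rewrite dS// mulr0 subr0 mulmxBl mxE [X in _ + X]mxE xS// pS// subrr.
Qed.

(** Covers equal subscripts, for which no tuple of [m + 1] distinct indices is available. *)
Lemma vertex_before_irr b S d k : (0 < m)%N -> #|S| = m.-1 -> k \notin S ->
  d != 0 -> ~ vertex_before (hyperplane a b) S d k k.
Proof.
move=> m0 Sm kS d0.
move=> [x [y [t [[/interP xS /hyperplaneE xk] [/interP yS /hyperplaneE yk]]]]].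
move=> t0 yx.
have : y - x = 0.
  apply: (@eval_inj (k |: S)); first by rewrite cardsU1 kS Sm add1n prednK.
  move=> i iS; rewrite mulmxBl mxE [X in _ + X]mxE.
  by case/setU1P: iS => [->|iS]; rewrite ?xk ?yk ?xS ?yS// subrr.
rewrite yx addrAC subrr add0r => /eqP; rewrite scaler_eq0 (negbTE d0) orbF.
by rewrite gt_eqF.
Qed.

(** With [x] the vertex on the [k]-th hyperplane and [t] the parameter from it to the vertex on the
    [l]-th, [disc a f b] equals [t * w]. Hence [disc a f b * w] has the sign of [t], while [w] is
    the same for all arrangements. *)
Lemma vertex_before_disc S d k l f : (0 < m)%N -> #|S| = m.-1 ->
    k \notin S -> l \notin S -> k != l -> d != 0 ->
    (forall i, i \in S -> (d *m a^T) 0 i = 0) ->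
    injective f -> f @: 'I_(m + 1) = k |: (l |: S) ->
  let w := (d *m a^T) 0 l * disc a f (delta_mx 0 l) in
  w != 0 /\ forall b,
    (vertex_before (hyperplane a b) S d k l <-> 0 < disc a f b * w) /\
    (vertex_before (hyperplane a b) S d l k <-> disc a f b * w < 0).
Proof.
move=> m0 Sm kS lS kl d0 dS finj fT w.
have kSm : #|k |: S| = m by rewrite cardsU1 kS Sm add1n prednK.
have dl : (d *m a^T) 0 l != 0 by exact: eval_neq0 dS.
have w0 : w != 0.
  (* Were the second factor 0, some point would take the value 0 on [k |: S], hence be the origin,
     and yet take the value 1 on row [l]. *)
  rewrite mulf_neq0//; apply/eqP => /(disc_eq0 finj) [x xf].
  have xT i : i \in k |: (l |: S) -> (x *m a^T) 0 i = (i == l)%:R.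
    by rewrite -fT => /imsetP [q _ ->]; rewrite xf mxE.
  have x0 : x = 0.
    apply: (eval_inj kSm) => i /setU1P [->|iS].
      by rewrite xT ?setU11// (negbTE kl).
    rewrite xT ?inE ?iS ?orbT//; case: eqP => // il.
    by rewrite -il iS in lS.
  have := xT l; rewrite x0 mul0mx mxE eqxx !inE eqxx orbT => /(_ isT) /esym /eqP.
  by rewrite oner_eq0.
split=> // b.
have [|x xS] := @solve_rows (k |: S) b; first by rewrite kSm.
set t := (b 0 l - (x *m a^T) 0 l) / (d *m a^T) 0 l.
have tE : t * (d *m a^T) 0 l = b 0 l - (x *m a^T) 0 l by rewrite divfK.
have Db : disc a f b * w = t * w ^+ 2.
  suff -> : disc a f b = t * w by rewrite expr2 mulrA.
  (* Moving the origin to [x] kills the constants of the tuple except the one at [l]. *)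
  have -> : disc a f b = disc a f (b - x *m a^T).
    by rewrite linearB /= disc_eval subr0.
  rewrite /w mulrA tE -discZ.
  apply: eq_disc => q.
  rewrite [LHS]mxE [X in _ + X]mxE [RHS]mxE [X in _ * X]mxE eqxx /=.
  have : f q \in k |: (l |: S) by rewrite -fT imset_f.
  case: eqP => [-> _|/eqP ql fqT]; first by rewrite mulr1.
  rewrite mulr0 xS ?subrr//; move: fqT; rewrite !inE (negbTE ql).
  by [].
have w2 : 0 < w ^+ 2 by rewrite exprn_even_gt0.
have vertexE (y : 'rV_m) :
    (inter (hyperplane a b) S `&` hyperplane a b k) y -> y = x.
  move=> [/interP yS /hyperplaneE yk]; apply/eqP; rewrite -subr_eq0; apply/eqP.
  apply: (eval_inj kSm) => i iS.
  rewrite mulmxBl mxE [X in _ + X]mxE xS//.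
  by case/setU1P: iS => [->|iS]; rewrite ?yk ?yS// subrr.
have vx : (inter (hyperplane a b) S `&` hyperplane a b k) x.
  by split; [apply/interP => i iS|apply/hyperplaneE];
    rewrite xS// !inE ?iS ?eqxx ?orbT.
have vxt : (inter (hyperplane a b) S `&` hyperplane a b l) (x + t *: d).
  split; [apply/interP => i iS|apply/hyperplaneE];
    rewrite mulmxDl -scalemxAl mxE [X in _ + X]mxE.
    by rewrite dS// mulr0 addr0 xS// !inE iS orbT.
  by rewrite tE addrC subrK.
have tP u : (x + u *: d) \in hyperplane a b l -> u = t.
  rewrite inE => /hyperplaneE; rewrite mulmxDl -scalemxAl mxE [X in _ + X]mxE => E.
  by apply: (mulIf dl); rewrite tE -E addrAC subrr add0r.
rewrite Db pmulr_lgt0// pmulr_llt0//; split; split=> [[y [z [u [Hy Hz u0 yz]]]]|t0].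
- suff <- : u = t by [].
  by apply: tP; rewrite -(vertexE _ Hy) -yz inE; case: Hz.
- by exists x, (x + t *: d), t.
- suff <- : - u = t by rewrite oppr_lt0.
  apply: tP; by rewrite -(vertexE _ Hz) yz scaleNr addrK inE; case: Hy.
- exists (x + t *: d), x, (- t); split=> //; first by rewrite oppr_gt0.
  by rewrite scaleNr addrK.
Qed.

(* Connectedness of the Johnson graph: (m+1)-sets are joined by exchanging one
   element at a time, and neighbours share an (m-1)-subset. *)
Lemma sign_constant (P : ('I_(m + 1) -> 'I_n) -> bool) :
    (forall S, #|S| = m.-1 -> exists e, forall f, injective f ->
       S \subset f @: 'I_(m + 1) -> P f = e) ->
  forall f g, injective f -> injective g -> P f = P g.
Proof.
move=> HP.
have near f g : injective f -> injective g ->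
    (m.-1 <= #|f @: 'I_(m + 1) :&: g @: 'I_(m + 1)|)%N -> P f = P g.
  move=> finj ginj /card_geqP [s [us ss sfg]].
  have [|e He] := HP [set i in s].
    by rewrite cardsE; move/card_uniqP: us => ->.
  rewrite !He//; apply/fintype.subsetP => i; rewrite inE => /sfg;
    by rewrite inE => /andP [].
move=> f g + ginj; have [N] := ubnP #|f @: 'I_(m + 1) :\: g @: 'I_(m + 1)|.
elim: N f => // N IHN f fgN finj.
have cT h : injective h -> #|h @: 'I_(m + 1)| = m.+1.
  by move=> hinj; rewrite card_imset// card_ord addn1.
have [fg|] := boolP (f @: 'I_(m + 1) \subset g @: 'I_(m + 1)).
  by apply: near => //; rewrite (finset.setIidPl fg) cT// (leq_trans (leq_pred m)).
move=> /subsetPn [x xf xg].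
have [y yg yf] : exists2 y, y \in g @: 'I_(m + 1) & y \notin f @: 'I_(m + 1).
  apply/subsetPn; apply: contraL isT => gf.
  have /eqP gfE : g @: 'I_(m + 1) == f @: 'I_(m + 1).
    by rewrite eqEcard gf !cT /=.
  by rewrite gfE xf in xg.
have cD : #|f @: 'I_(m + 1) :\ x| = m.
  by apply: succn_inj; rewrite -(cT _ f finj) (cardsD1 x (f @: 'I_(m + 1))) xf.
(* The tuple [h] trades [x] for [y]. It shares [m] indices with [f], enough for [near], and has
   fewer indices outside the image of [g]. *)
have [|h [/homo_ltn_inj hinj hT]] :=
    @increasing_enum _ (m + 1) (y |: (f @: 'I_(m + 1) :\ x)).
  by rewrite cardsU1 !inE (negbTE yf) andbF cD addnC.
rewrite (near f h) //; last first.
  apply: (leq_trans (leq_pred m)); rewrite -[X in (X <= _)%N]cD.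
  apply/subset_leq_card/fintype.subsetP => i ix; rewrite inE hT inE ix orbT andbT.
  by move: ix; rewrite inE => /andP [].
apply: IHN => //; apply: leq_trans (fgN : (_ <= N)%N).
apply: proper_card; apply/properP; split.
  apply/fintype.subsetP => i; rewrite !inE hT => /andP [ig]; rewrite !inE.
  case/orP => [/eqP iy|/andP [_ ->]]; last by rewrite ig.
  by rewrite iy yg in ig.
exists x; first by rewrite inE xg xf.
rewrite inE hT !inE eqxx /= orbF negb_and negbK.
by apply/orP; right; apply: contraNneq xg => ->.
Qed.

(** * Isomorphism of generic arrangements in terms of discriminant signs *)

Lemma iso_hyperplaneP y z : (0 < m < n)%N -> regular a y -> regular a z ->
  iso_trivial_on_subscripts (hyperplane a y) (hyperplane a z) <->
  same_signs a y z \/ same_signs a y (- z).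
Proof.
move=> mn yreg zreg; have m0 : (0 < m)%N by case/andP: mn.
split=> [iso|sgn S Sm d1 d2].
  pose P f := 0 < disc a f y * disc a f z.
  have Pconst f g : injective f -> injective g -> P f = P g.
    apply: sign_constant => {f g} S Sm.
    have [d dir] : exists d, d != 0 /\ forall i, i \in S -> (d *m a^T) 0 i = 0.
      (* The direction space has dimension [m - m.-1], that is 1, so [vpick] returns a nonzero
         vector. *)
      have [|p [U [dU E]]] := @inter_affine_dim y S; first by rewrite Sm leq_pred.
      exists (vpick U); rewrite vpick0 -dimv_eq0 dU Sm; split.
        by rewrite -lt0n subn_gt0 prednK.
      apply: (@inter_direction _ _ _ a y S p); rewrite E.
        by exists 0; rewrite /= ?mem0v// addr0.
      by exists (vpick U); rewrite //= memv_pick.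
    have [d0 dS] := dir.
    have split_kl f : injective f -> S \subset f @: 'I_(m + 1) ->
        exists k l, [/\ k \notin S, l \notin S, k != l
          & f @: 'I_(m + 1) = k |: (l |: S)].
      move=> finj Sf.
      have /eqP/cards2P [k [l [kl klE]]] : #|f @: 'I_(m + 1) :\: S| = 2%N.
        rewrite cardsD (finset.setIidPr Sf) card_imset// card_ord Sm addn1.
        by rewrite -{1}(prednK m0) -addn2 addKn.
      have inkl i : (i \in [set k; l]%SET) =
          (i \notin S) && (i \in f @: 'I_(m + 1)).
        by rewrite -klE inE.
      exists k, l; split=> //.
      - by have := inkl k; rewrite !inE eqxx => /esym /andP [].
      - by have := inkl l; rewrite !inE eqxx orbT => /esym /andP [].
      - apply/setP => i; have := inkl i; rewrite !inE orbA => ->.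
        by have [iS|] := boolP (i \in S); rewrite ?orbT ?orbF//= (fintype.subsetP Sf).
    (* One direction [d] orients both lines, so [w] is common to both arrangements and the
       alternative chosen for [S] fixes the value of [P]. *)
    have [same|opp] := iso S Sm d d (proj2 (line_directionE y d mn Sm) dir)
        (proj2 (line_directionE z d mn Sm) dir).
    - exists true => f finj /(split_kl f finj) [k [l [kS lS kl fT]]].
      have [w0 vb] := vertex_before_disc m0 Sm kS lS kl d0 dS finj fT.
      apply: mulr_gt0_iff (yreg _ finj) (mulf_neq0 (zreg _ finj) w0) _.
      by rewrite -(proj1 (vb y)) -(proj1 (vb z)) same.
    - exists false => f finj /(split_kl f finj) [k [l [kS lS kl fT]]].
      have [w0 vb] := vertex_before_disc m0 Sm kS lS kl d0 dS finj fT.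
      apply/negbTE/negP; apply: mulr_gt0_opp (mulf_neq0 (zreg _ finj) w0) _.
      by rewrite -(proj1 (vb y)) -(proj2 (vb z)) opp.
  (* If one product fails to be positive, constancy of [P] and regularity make all of them
     negative. *)
  have [Pall|] := pselect (same_signs a y z); first by left.
  move=> /existsNP [g /not_implyP [ginj gneg]]; right=> f finj.
  rewrite linearN /= mulrN oppr_gt0 ltNge le_eqVlt negb_or eq_sym.
  rewrite mulf_neq0 ?yreg ?zreg//=; apply/negP => fpos; apply: gneg.
  by have := Pconst _ _ finj ginj; rewrite /P fpos => <-.
move=> /(line_directionE _ _ mn Sm) dir1 /(line_directionE _ _ mn Sm) [d20 d2S].
have [d10 d1S] := dir1.
have [c c0 d2E] : exists2 c, c != 0 & d2 = c *: d1.
  (* With zero constants the line of [S] contains both the origin and [d2]. The base point [p] is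
     arbitrary, so [c] is a difference of two parameters. *)
  have [_ [p E]] := proj2 (line_directionE 0 d1 mn Sm) dir1.
  have : inter (hyperplane a 0) S 0.
    by apply/interP => i iS; rewrite mul0mx !mxE.
  have : inter (hyperplane a 0) S d2.
    by apply/interP => i iS; rewrite d2S// mxE.
  rewrite E => -[t2 _ t2E] [t0 _ t0E]; exists (t2 - t0).
    by apply: contra_neq d20 => /eqP; rewrite subr_eq0 -t2E => /eqP ->.
  by rewrite scalerBl -[LHS]subr0 -{1}t2E -t0E opprD addrACA subrr add0r.
(* The sign [e] merges the two alternatives; with the ratio [c] of the directions, the sign of
   [e * c] decides whether the orders agree or are reversed. *)
have [e [e2 sgne]] : exists e, e ^+ 2 = 1 /\ same_signs a y (e *: z).
  case: sgn => sgn; first by exists 1; rewrite expr1n scale1r.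
  by exists (-1); rewrite sqrrN expr1n scaleN1r.
have e0 : e != 0 by rewrite -sqrf_eq0 e2 oner_eq0.
have sgn_w f w : injective f -> 
    (0 < disc a f y * w) = (0 < (e * c) * (disc a f z * (c * w))).
  move=> finj; rewrite (mulr_gt0_congr _ (sgne f finj)) discZ.
  have c2 : 0 < c ^+ 2 by rewrite exprn_even_gt0.
  by rewrite -(pmulr_rgt0 _ c2); congr (0 < _); ring.
have enum_kl k l : k \notin S -> l \notin S -> k != l ->
    exists2 f, injective f & f @: 'I_(m + 1) = k |: (l |: S).
  move=> kS lS kl; have [|f [/homo_ltn_inj finj fT]] :=
      @increasing_enum _ (m + 1) (k |: (l |: S)).
    by rewrite !cardsU1 !inE negb_or kl kS lS Sm !add1n prednK// addn1.
  by exists f.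
have d1l l f : (d2 *m a^T) 0 l * disc a f (delta_mx 0 l) =
    c * ((d1 *m a^T) 0 l * disc a f (delta_mx 0 l)).
  by rewrite d2E -scalemxAl mxE mulrA.
have ec0 : e * c != 0 by rewrite mulf_neq0.
have [ec|ec|/esym/eqP] := ltgtP 0 (e * c); last by rewrite (negbTE ec0).
- left=> k l kS lS; have [<-|kl] := eqVneq k l.
    by split=> /vertex_before_irr; case.
  have [f finj fT] := enum_kl k l kS lS kl.
  have [_ vb1] := vertex_before_disc m0 Sm kS lS kl d10 d1S finj fT.
  have [_ vb2] := vertex_before_disc m0 Sm kS lS kl d20 d2S finj fT.
  by rewrite (proj1 (vb1 y)) (proj1 (vb2 z)) d1l sgn_w// pmulr_rgt0.
- right=> k l kS lS; have [<-|kl] := eqVneq k l.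
    by split=> /vertex_before_irr; case.
  have [f finj fT] := enum_kl k l kS lS kl.
  have [_ vb1] := vertex_before_disc m0 Sm kS lS kl d10 d1S finj fT.
  have [_ vb2] := vertex_before_disc m0 Sm kS lS kl d20 d2S finj fT.
  by rewrite (proj1 (vb1 y)) (proj2 (vb2 z)) d1l sgn_w// nmulr_rgt0.
Qed.

End NormalSystems.

(** * Cells and cones of the discriminantal arrangement *)

Lemma continuous_mull {R : realType} {T : topologicalType} (c : R) (g : T -> R) :
  continuous g -> continuous (fun x => c * g x).
Proof. by move=> gc x; apply: cvgM; [exact: cvg_cst|exact: gc]. Qed.

Section Cells.
Context {R : realType} {n m : nat} (a : 'M[R]_(n, m)).
Implicit Types (y z : 'rV[R]_n) (f : 'I_(m + 1) -> 'I_n).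

Lemma same_signs_refl y : regular a y -> same_signs a y y.
Proof. by move=> yreg f finj; rewrite -expr2 exprn_even_gt0//= yreg. Qed.

Lemma same_signs_sym y z : same_signs a y z -> same_signs a z y.
Proof. by move=> yz f finj; rewrite mulrC yz. Qed.

Lemma same_signs_trans z y w :
  same_signs a y z -> same_signs a z w -> same_signs a y w.
Proof. by move=> yz zw f finj; rewrite (mulr_gt0_congr _ (yz f finj)) zw. Qed.

Lemma same_signsNN y z : same_signs a (- y) (- z) <-> same_signs a y z.
Proof. by split=> yz f /yz; rewrite !linearN /= mulrNN. Qed.

Lemma same_signsNl y z : same_signs a (- y) z <-> same_signs a y (- z).
Proof. by rewrite -same_signsNN opprK. Qed.

Lemma regularN y : regular a y -> regular a (- y).
Proof. by move=> yreg f /yreg; rewrite linearN oppr_eq0. Qed.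

Lemma disc_continuous f : continuous (disc a f).
Proof.
have -> : disc a f = fun y => \sum_i disc a f (delta_mx 0 i) * y 0 i.
  apply/funext => y; rewrite {1}(row_sum_delta y) linear_sum /=.
  by apply: eq_bigr => i _; rewrite discZ mulrC.
apply: continuous_big => [|i _]; first exact: add_continuous.
by apply: continuous_mull; apply: coord_continuous.
Qed.

(** A discriminant without zeros on a connected set keeps its sign there, by intermediate values.
    Conversely, linearity keeps all signs along the segment between two vectors with the same
    signs. *)
Lemma connected_component_regular y : regular a y ->
  connected_component (regular a) y = same_signs a y.
Proof.
move=> yreg; apply/seteqP; split=> z.
  move=> [C [Cy CU Cc] Cz] f finj.
  have := connected_continuous_connected Cc
    (continuous_subspaceT (@disc_continuous f)).
  move/connected_intervalP => itv; rewrite ltNge; apply/negP => yz.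
  have : (disc a f @` C) 0.
    have [y0|y0] := leP 0 (disc a f y).
      have z0 : disc a f z <= 0.
        by move: yz; rewrite pmulr_rle0// lt_neqAle eq_sym yreg.
      by apply: (itv (disc a f z) (disc a f y)); [exists z|exists y|apply/andP].
    have z0 : 0 <= disc a f z by move: yz; rewrite nmulr_rle0.
    by apply: (itv (disc a f y) (disc a f z)); [exists y|exists z|rewrite (ltW y0)].
  by move=> [w Cw]; apply/eqP/CU.
move=> yz.
pose seg (t : R) := y + t *: (z - y).
have segc : continuous seg.
  by move=> t; apply: cvgD; [exact: cvg_cst|apply: cvgZr_tmp; exact: cvg_id].
exists (seg @` `[0, 1]%classic); last first.
  by exists 1; rewrite /= ?in_itv/= ?ler01 ?lexx// /seg scale1r addrC subrK.
split.
- by exists 0; rewrite /= ?in_itv/= ?ler01 ?lexx// /seg scale0r addr0.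
- move=> _ [t + <-]; rewrite /= in_itv /= => /andP [t0 t1] f finj.
  have yzf := yz f finj; have yf := same_signs_refl yreg finj.
  suff : 0 < disc a f y * disc a f (seg t).
    by apply: contraTneq => ->; rewrite mulr0 ltxx.
  rewrite /seg linearD /= discZ linearB /=.
  (* A convex combination of two positive numbers; [t = 0] is split off so that the second term is
     positive in the other case. *)
  rewrite (_ : _ * _ = (1 - t) * (disc a f y * disc a f y) +
                      t * (disc a f y * disc a f z)); last by ring.
  have [->|t0'] := eqVneq t 0; first by rewrite mul0r subr0 mul1r addr0.
  apply: ltr_wpDl; first by rewrite mulr_ge0 ?subr_ge0// ltW.
  by rewrite mulr_gt0// lt_neqAle eq_sym t0'.
- apply: connected_continuous_connected; first exact: segment_connected.
  exact: continuous_subspaceT.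
Qed.

Definition cone y := closure (connected_component (regular a) y).

(** Taking closures does not merge cells: strict inequalities become weak on the closure, but
    regularity of [y] makes them strict again at [y]. *)
Lemma eq_cone y z : regular a y -> regular a z ->
  cone y = cone z <-> same_signs a y z.
Proof.
move=> yreg zreg; rewrite /cone !connected_component_regular//.
split=> [yz f finj|yz]; last first.
  congr closure; apply/seteqP; split=> w; apply: same_signs_trans => //.
  exact: same_signs_sym.
have : closure (same_signs a z) y.
  by rewrite -yz; apply/subset_closure/same_signs_refl.
have clo : closed [set w | 0 <= disc a f z * disc a f w].
  rewrite (_ : [set w | _] =
    (fun w => disc a f z * disc a f w) @^-1` [set x | 0 <= x])//.
  apply: preimage_closed; last exact: closed_ge.
  by move=> w _; apply: continuous_mull; exact: disc_continuous.
have sub : same_signs a z `<=` [set w | 0 <= disc a f z * disc a f w].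
  by move=> w /(_ f finj) /ltW.
move=> /(closureS sub); rewrite -(proj1 (closure_id _) clo) /= => yz0.
by rewrite lt_neqAle mulrC yz0 andbT eq_sym mulf_neq0 ?yreg ?zreg.
Qed.

Lemma coneN y : regular a y -> [set - x | x in cone y] = cone (- y).
Proof.
have sub z : regular a z -> [set - x | x in cone z] `<=` cone (- z).
  move=> zreg _ [x + <-].
  rewrite /cone !connected_component_regular//; last exact: regularN.
  move=> xz B /(@opp_continuous 'rV[R]_n x) /xz [w [zw Bw]].
  by exists (- w); split=> //; apply/same_signsNN.
move=> yreg; apply/seteqP; split; first exact: sub.
move=> x xN; exists (- x); last by rewrite opprK.
by rewrite -[y]opprK; apply: sub; [exact: regularN|exists x].
Qed.

Definition cone_pair y := [set cone y; [set - x | x in cone y]].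

Lemma eq_cone_pair y z : regular a y -> regular a z ->
  cone_pair y = cone_pair z <-> same_signs a y z \/ same_signs a y (- z).
Proof.
move=> yreg zreg; have zNreg := regularN zreg; have yNreg := regularN yreg.
rewrite /cone_pair !coneN//; split.
  move=> E; have : [set cone z; cone (- z)] (cone y) by rewrite -E; left.
  by case=> /eq_cone => [/(_ yreg zreg)|/(_ yreg zNreg)]; [left|right].
case=> yz.
  congr [set _; _]; first exact/eq_cone.
  by apply/eq_cone => //; apply/same_signsNN.
rewrite setUC; congr [set _; _]; last exact/eq_cone.
by apply/eq_cone => //; apply/same_signsNl.
Qed.

End Cells.

(** * Bijections between images, and counting by sign vectors *)

Lemma image_set_bij {T : pointedType} {U V : Type} (A : set T)
    (F : T -> U) (G : T -> V) :
    (forall s t, A s -> A t -> F s = F t <-> G s = G t) ->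
  exists h, set_bij (F @` A) (G @` A) h.
Proof.
(* Maps with the same fibres have images in bijection, through a chosen preimage; the default
   [point] is never returned on the image of [A]. *)
move=> FG; pose rep u := xget point [set t | A t /\ F t = u].
have repP t : A t -> A (rep (F t)) /\ F (rep (F t)) = F t.
  by move=> At; apply: (@xgetI _ point [set s | A s /\ F s = F t] t).
have Grep t : A t -> G (rep (F t)) = G t.
  by move=> At; have [? ?] := repP t At; apply/FG.
exists (fun u => G (rep u)); split.
- by move=> _ [t At <-]; exists t; rewrite ?Grep.
- move=> _ _ /set_mem [s As <-] /set_mem [t At <-].
  by rewrite !Grep// => /FG; apply.
- by move=> _ [t At <-]; exists (F t); [exists t|rewrite Grep].
Qed.

Lemma card_eq_setXbool {T : Type} (A : set T) (k : nat) :
  A #= `I_k -> A `*` [set: bool] #= `I_(2 * k).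
Proof.
move=> /card_set_bijP [g [gA ginj gsurj]]; apply/card_set_bijP.
(* The [true] copy of [A] is numbered after the [false] one, shifted by [k]. *)
exists (fun p : T * bool => (g p.1 + p.2 * k)%N); split.
- move=> [t b] [/gA /= tk _].
  by case: b => /=; rewrite mul2n -addnn ?mul1n ?ltn_add2r// mul0n addn0 ltn_addr.
- move=> [s b] [t c] /set_mem [/= As _] /set_mem [/= At _] /=.
  have := gA _ As; have := gA _ At; move=> /= tk sk.
  case: b c => [] [] /=; rewrite ?mul1n ?mul0n ?addn0.
  + by move=> /addIn /ginj -> //; apply/mem_set.
  + by move=> E; rewrite -E ltnNge leq_addl in tk.
  + by move=> E; rewrite E ltnNge leq_addl in sk.
  + by move=> /ginj -> //; apply/mem_set.
- move=> i /= ik; have [ik'|ki] := ltnP i k.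
    have [t At ti] := gsurj i ik'.
    by exists (t, false) => //=; rewrite mul0n addn0.
  have [|t At ti] := gsurj (i - k)%N.
    by rewrite /= ltn_subLR// addnn -mul2n.
  by exists (t, true) => //=; rewrite mul1n ti subnK.
Qed.

Section SignVectors.
Context {R : realType} {n m : nat} (a : 'M[R]_(n, m)).
Implicit Types (y z : 'rV[R]_n) (f : 'I_(m + 1) -> 'I_n).

(** A code for the cell of [y] in a finite type, from which the finiteness of the count is drawn. *)
Definition sign_vector y : {ffun {ffun 'I_(m + 1) -> 'I_n} -> bool} :=
  [ffun f : {ffun 'I_(m + 1) -> 'I_n} => injectiveb f && (0 < disc a f y)].

Lemma eq_sign_vector y z : regular a y -> regular a z ->
  sign_vector y = sign_vector z <-> same_signs a y z.
Proof.
move=> yreg zreg; split=> [yz f finj|yz].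
  have fE : (finfun f : _ -> _) = f by apply/funext => q; rewrite ffunE.
  have /ffunP/(_ (finfun f)) := yz.
  rewrite !ffunE fE; have -> : injectiveb f by apply/injectiveP.
  rewrite /= => E; have := mulf_neq0 (yreg f finj) (zreg f finj).
  have [] := ltgtP 0 (disc a f y * disc a f z) => // neg _.
  have /mulr_gt0_congr : 0 < disc a f y * - disc a f z by rewrite mulrN oppr_gt0.
  move=> /(_ 1); rewrite !mulr1 E oppr_gt0; have := zreg f finj.
  by case: ltgtP.
apply/ffunP => f; rewrite !ffunE; case: injectiveP => //= finj.
by have := mulr_gt0_congr 1 (yz f finj); rewrite !mulr1.
Qed.

(** For regular [y] and injective [f], selects the member of the pair [y], [- y] on which the
    discriminant of [f] is positive. *)
Definition normalize f y := if 0 < disc a f y then y else - y.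

Lemma regular_normalize f y : regular a y -> regular a (normalize f y).
Proof.
by move=> yreg; rewrite /normalize; case: ifP => // _; apply: regularN.
Qed.

Lemma normalizeN f y : injective f -> regular a y ->
  normalize f (- y) = normalize f y.
Proof.
move=> finj /(_ f finj) y0; rewrite /normalize linearN /= oppr_gt0 opprK.
by case: ltgtP y0.
Qed.

Lemma same_signs_normalize f y z : injective f -> regular a y -> regular a z ->
  same_signs a (normalize f y) (normalize f z) <->
  same_signs a y z \/ same_signs a y (- z).
Proof.
move=> finj yreg zreg; split.
  rewrite /normalize; case: ifP => _; case: ifP => _;
    rewrite ?same_signsNN ?same_signsNl; tauto.
have sgn y' z' : same_signs a y' z' -> (0 < disc a f y') = (0 < disc a f z').
  by move=> /(_ f finj) /(mulr_gt0_congr 1); rewrite !mulr1.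
have norm y' z' : same_signs a y' z' ->
    same_signs a (normalize f y') (normalize f z').
  move=> yz; rewrite /normalize (sgn _ _ yz); case: ifP => // _.
  exact/same_signsNN.
by case=> /norm //; rewrite normalizeN.
Qed.

Lemma eq_sign_normalize f y z : injective f -> regular a y -> regular a z ->
  (sign_vector (normalize f y), 0 < disc a f y) =
  (sign_vector (normalize f z), 0 < disc a f z) <-> same_signs a y z.
Proof.
move=> finj yreg zreg; split=> [[/eq_sign_vector]|yz].
  move=> /(_ (regular_normalize _ yreg) (regular_normalize _ zreg)).
  by move=> + yz; rewrite /normalize -yz; case: ifP => // _ /same_signsNN.
congr pair; last by have := mulr_gt0_congr 1 (yz f finj); rewrite !mulr1.
apply/eq_sign_vector; [exact: regular_normalize..|].
by apply/same_signs_normalize => //; left.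
Qed.

(** Negating [y] flips the boolean and keeps the normalized vector, so both booleans occur with each
    vector: this is the factor 2 of the count. *)
Lemma image_sign_normalize f : injective f ->
  [set (sign_vector (normalize f y), 0 < disc a f y) | y in regular a] =
  [set sign_vector (normalize f y) | y in regular a] `*` [set: bool].
Proof.
move=> finj; apply/seteqP; split=> [_ [y yreg <-]|[_ b] [/= [y yreg <-] _]].
  by split=> //; exists y.
have [<-|neg] := eqVneq (0 < disc a f y) b; first by exists y.
exists (- y); first exact: regularN.
rewrite normalizeN//; congr pair; rewrite linearN /= oppr_gt0.
by have := yreg f finj; move: neg; case: b; case: ltgtP.
Qed.

End SignVectors.

(** * Classes, cones and antipodal pairs as images of the regular vectors *)

Theorem theoremA (R : realType) (n m : nat)
    (L : 'I_n -> {vspace 'rV[R]_m}) (a : 'M[R]_(n, m))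
    (hm : (1 < m)%N) (hn : (m < n)%N) (hN : normal_system L a) :
  (exists f : set ('I_n -> set 'rV[R]_m) -> set (set 'rV[R]_n),
     set_bij (iso_classes a) (antipodal_pairs a) f) /\
  (exists k : nat,
     (iso_classes a #= `I_k) /\ (convex_cones a #= `I_(2 * k))).
Proof.
have mn : (0 < m < n)%N by rewrite hn ltnW.
pose iso_class (y : 'rV[R]_n) := [set K | generic_arrangements a K /\
  iso_trivial_on_subscripts (hyperplane a y) K].
have genP H : generic_arrangements a H <->
    exists2 y, regular a y & H = hyperplane a y.
  split=> [[[y ->] /(generic_hyperplane hN) yreg]|[y yreg ->]]; first by exists y.
  by split; [exists y|apply/(generic_hyperplane hN)].
have isoE : iso_classes a = iso_class @` regular a.
  apply/seteqP; split=> [_ [H /genP [y yreg ->] <-]|_ [y yreg <-]]; first by exists y.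
  by exists (hyperplane a y) => //; apply/genP; exists y.
have conesE : convex_cones a = cone a @` regular a.
  by rewrite /convex_cones (compl_discriminantal hN).
have pairsE : antipodal_pairs a = cone_pair a @` regular a.
  by rewrite /antipodal_pairs conesE image_comp.
have eq_iso y z : regular a y -> regular a z ->
    iso_class y = iso_class z <-> same_signs a y z \/ same_signs a y (- z).
  move=> yreg zreg; split.
    move=> E; have : iso_class z (hyperplane a z).
      split; first by apply/genP; exists z.
      by apply/(iso_hyperplaneP hN) => //; left; apply: same_signs_refl.
    by rewrite -E => -[_ /(iso_hyperplaneP hN mn yreg zreg)].
  have sub u v : regular a u -> regular a v ->
      same_signs a u v \/ same_signs a u (- v) -> iso_class v `<=` iso_class u.
    move=> ureg vreg uv _ [/genP [w wreg ->]].
    move=> /(iso_hyperplaneP hN mn vreg wreg) vw.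
    split; first by apply/genP; exists w.
    apply/(iso_hyperplaneP hN mn ureg wreg).
    case: uv vw => uv [] vw.
    - by left; apply: same_signs_trans vw.
    - by right; apply: same_signs_trans vw.
    - by right; apply: (same_signs_trans uv); apply/same_signsNN.
    - by left; apply: (same_signs_trans uv); apply/same_signsNl.
  move=> yz; apply/seteqP; split; apply: sub => //.
  case: yz => yz; [left|right]; first exact: same_signs_sym.
  by apply/same_signsNl; apply: same_signs_sym.
split.
  rewrite isoE pairsE; apply: image_set_bij => y z yreg zreg.
  by rewrite eq_iso// eq_cone_pair.
(* A reference tuple of distinct indices, available because [m < n]; its sign selects a member of
   each antipodal pair. *)
pose f0 : 'I_(m + 1) -> 'I_n := widen_ord (leq_trans (eq_leq (addn1 m)) hn).
have f0inj : injective f0 by apply: homo_ltn_inj.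
have : finite_set [set sign_vector a (normalize a f0 y) | y in regular a].
  exact: finite_finset.
(* Here [k] counts the normalized sign vectors. Classes correspond to these vectors, cones to the
   vectors paired with the sign at [f0]. *)
move=> /finite_setP [k Xk]; exists k; split.
  apply: card_eq_trans Xk; rewrite isoE card_eq_sym; apply/card_set_bijP.
  apply: image_set_bij => y z yreg zreg.
  rewrite eq_iso// eq_sign_vector; [|exact: regular_normalize..].
  by rewrite same_signs_normalize.
apply: card_eq_trans (card_eq_setXbool Xk).
rewrite -image_sign_normalize// conesE card_eq_sym; apply/card_set_bijP.
apply: image_set_bij => y z yreg zreg.
by rewrite eq_cone// eq_sign_normalize.
Qed.
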